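(* Let $G$ be a torsion-free amenable group. Assume that $G \curvearrowright X$ and $H \curvearrowright Y$ are topologically free systems on compact spaces $X$ and $Y$, and suppose that $G \curvearrowright X$ and $H \curvearrowright Y$ are continuously orbit equivalent. If $G \curvearrowright X$ is continuous $H$-cocycle rigid, then $G \curvearrowright X$ and $H \curvearrowright Y$ must be conjugate.
   Context: All groups are discrete and countable; all topological spaces are locally compact and Hausdorff. A (topological dynamical) system $G \curvearrowright X$ is an action $(g,x) \mapsto g.x$ of a group $G$ on a space $X$ by homeomorphisms. It is topologically free if for every $e \neq g \in G$ the set $\{x \in X : g.x \neq x\}$ is dense in $X$. $G \curvearrowright X$ and $H \curvearrowright Y$ are continuously orbit equivalent if there exist a homeomorphism $\varphi: X \to Y$ with inverse $\psi$ and continuous maps $a: G \times X \to H$, $b: H \times Y \to G$ (with $G$, $H$ discrete) such that $\varphi(g.x) = a(g,x).\varphi(x)$ and $\psi(h.y) = b(h,y).\psi(y)$ for all $g,x,h,y$. They are conjugate if there are a homeomorphism $\varphi: X \to Y$ and a group isomorphism $\rho: G \to H$ with $\varphi(g.x) = \rho(g).\varphi(x)$ for all $g \in G$, $x \in X$. A continuous $H$-cocycle for $G \curvearrowright X$ is a continuous map $a: G \times X \to H$ with $a(g_1g_2,x) = a(g_1,g_2.x)a(g_2,x)$ for all $g_1,g_2 \in G$, $x \in X$. Two such cocycles $a,a'$ are continuously cohomologous ($a \sim a'$) if there is a continuous map $u: X \to H$ with $a(g,x) = u(g.x)a'(g,x)u(x)^{-1}$ for all $g,x$. $G \curvearrowright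 X$ is continuous $H$-cocycle rigid if every continuous $H$-cocycle for $G \curvearrowright X$ is continuously cohomologous to a group homomorphism $\rho: G \to H$, viewed as the cocycle $(g,x) \mapsto \rho(g)$. *)

(* Defs.v *)
From HB Require Import structures.
From mathcomp Require Import all_boot all_order all_algebra.
From mathcomp Require Import all_classical all_reals all_analysis.

Set Implicit Arguments.
Unset Strict Implicit.
Unset Printing Implicit Defensive.

Import Order.TTheory GRing.Theory Num.Theory.

Local Open Scope classical_set_scope.
Local Open Scope group_scope.

(** Groups are abstract, possibly infinite [groupType]s.  A [groupType] carries
    no topology; wherever continuity is at stake, a group [G] is replaced by its
    alias [discrete_topology G]. *)

Definition torsion_free (G : groupType) : Prop :=
  forall (g : G) (n : nat), (0 < n)%N -> g ^+ n = 1 -> g = 1.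

(** von Neumann's definition for discrete groups: a left-invariant, finitely
    additive probability measure defined on all subsets of [G]. *)
Definition amenable (R : realType) (G : groupType) : Prop :=
  exists mu : set G -> R,
    [/\ forall A, (0 <= mu A)%R,
        mu [set: G] = 1%R,
        forall A B, A `&` B = set0 -> mu (A `|` B) = (mu A + mu B)%R
      & forall (g : G) A, mu [set g * x | x in A] = mu A].

Definition inverse_homeomorphisms (X Y : topologicalType)
    (phi : X -> Y) (psi : Y -> X) : Prop :=
  [/\ cancel phi psi, cancel psi phi, continuous phi & continuous psi].

Definition homeomorphism (X Y : topologicalType) (phi : X -> Y) : Prop :=
  exists psi : Y -> X, inverse_homeomorphisms phi psi.

Record system (G : groupType) (X : topologicalType) := System {
  act :> G -> X -> X;
  act1 : forall x, act 1 x = x;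
  actM : forall g h x, act (g * h) x = act g (act h x);
  act_homeo : forall g, homeomorphism (act g)
}.

Definition topologically_free (G : groupType) (X : topologicalType)
    (T : system G X) : Prop :=
  forall g : G, g <> 1 -> dense [set x | T g x <> x].

Definition continuous_from_action_space (G : groupType) (X : topologicalType)
    (H : groupType) (a : G * X -> H) : Prop :=
  continuous (a : discrete_topology G * X -> discrete_topology H).

Definition continuous_to_group (X : topologicalType) (H : groupType)
    (u : X -> H) : Prop :=
  continuous (u : X -> discrete_topology H).

Definition continuously_orbit_equivalent (G H : groupType)
    (X Y : topologicalType) (S : system G X) (T : system H Y) : Prop :=
  exists (phi : X -> Y) (psi : Y -> X) (a : G * X -> H) (b : H * Y -> G),
    [/\ inverse_homeomorphisms phi psi,
        continuous_from_action_space a,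
        continuous_from_action_space b,
        forall g x, phi (S g x) = T (a (g, x)) (phi x)
      & forall h y, psi (T h y) = S (b (h, y)) (psi y)].

Definition conjugate (G H : groupType) (X Y : topologicalType)
    (S : system G X) (T : system H Y) : Prop :=
  exists (phi : X -> Y) (rho : {multiplicative G -> H}),
    [/\ homeomorphism phi,
        bijective rho
      & forall g x, phi (S g x) = T (rho g) (phi x)].

Definition continuous_cocycle (G H : groupType) (X : topologicalType)
    (S : system G X) (a : G * X -> H) : Prop :=
  continuous_from_action_space a /\
  forall g1 g2 x, a (g1 * g2, x) = a (g1, S g2 x) * a (g2, x).

Definition continuously_cohomologous (G H : groupType) (X : topologicalType)
    (S : system G X) (a a' : G * X -> H) : Prop :=
  exists2 u : X -> H, continuous_to_group u &
    forall g x, a (g, x) = u (S g x) * a' (g, x) * (u x)^-1.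

Definition continuous_cocycle_rigid (G H : groupType) (X : topologicalType)
    (S : system G X) : Prop :=
  forall a : G * X -> H, continuous_cocycle S a ->
    exists rho : {multiplicative G -> H},
      continuously_cohomologous S a (fun p => rho p.1).

Arguments continuous_cocycle_rigid {G} H {X} S.

(* Main.v *)
(** An orbit equivalence cocycle [a] restricts to bijections [g |-> a(g, x)], and
    rigidity writes it as [a(g, x) = u(g.x) rho(g) u(x)^-1] with [u] finitely
    valued, [X] being compact.  So [rho : G -> H] is, up to left multiplication
    by a finite set, a bijection: its kernel is finite, hence trivial as [G] is
    torsion free, and it is onto, since otherwise [G] would contain two disjoint
    piecewise translated copies of itself, against amenability.  Then
    [x |-> u(x)^-1.phi(x)] is the conjugacy along [rho]. *)

Require Import Defs.
From HB Require Import structures.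
From mathcomp Require Import all_boot all_order all_algebra.
From mathcomp Require Import all_classical all_reals all_analysis.

Local Open Scope classical_set_scope.

(** * Invariant means and piecewise translations *)

Section Amenability.
Local Open Scope group_scope.
Import Order.TTheory GRing.Theory Num.Theory.
Context {R : realType} {G : groupType}.

(** Induction on [s]: where [k] is left translation by the head [c], invariance preserves the mean;
    injectivity of [k] keeps the image of the rest disjoint from that piece. *)
Lemma mean_piecewise_translation (mu : set G -> R) (k : G -> G) (s : seq G)
    (A : set G)
    (muU : forall A B, A `&` B = set0 -> mu (A `|` B) = (mu A + mu B)%R)
    (mu_inv : forall g A, mu [set g * x | x in A] = mu A)
    (k_inj : injective k) (ks : forall g, A g -> k g / g \in s) :
  mu (k @` A) = mu A.
Proof.
elim: s A ks => [|c s IHs] A ks.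
  suff -> : A = set0 by rewrite image_set0.
  by apply/seteqP; split => // g /ks.
pose A1 := A `&` [set g | k g / g = c]; pose A2 := A `&` [set g | k g / g <> c].
have AE : A = A1 `|` A2.
  by rewrite -setIUr; apply/esym/setIidPl => g _; exact: EM.
have A120 : A1 `&` A2 = set0 by apply/seteqP; split => // g [[_ /= gc] [_ /=]].
have kA120 : k @` A1 `&` k @` A2 = set0.
  apply/seteqP; split => // _ [[g Ag <-] [g' Ag' /k_inj gg']].
  by suff: set0 g by []; rewrite -A120; split => //; rewrite -gg'.
have kA1 : k @` A1 = [set c * x | x in A1].
  by apply/seteqP; split => _ [g [Ag /= gc] <-]; exists g;
    rewrite // -gc mulgVK.
rewrite AE image_setU !muU// kA1 mu_inv IHs// => g [Ag /= gc].
by have := ks g Ag; rewrite inE => /orP[/eqP|].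
Qed.

(** Each range has mean 1, so disjoint ranges would give total mean at least 2. *)
Lemma amenable_not_paradoxical (k1 k2 : G -> G) : amenable R G ->
  injective k1 -> injective k2 ->
  finite_set (range (fun g => k1 g / g)) ->
  finite_set (range (fun g => k2 g / g)) ->
  range k1 `&` range k2 <> set0.
Proof.
move=> [mu [mu_ge0 mu1 muU mu_inv]] k1_inj k2_inj.
move=> /finite_seqP[s1 s1E] /finite_seqP[s2 s2E] k12.
have mu_range (k : G -> G) (s : seq G) : injective k ->
    range (fun g => k g / g) = [set` s] -> mu (range k) = 1%R.
  move=> k_inj sE; rewrite (mean_piecewise_translation mu k s)// => g _.
  by have : [set` s] (k g / g) by rewrite -sE; exists g.
have := mu1; rewrite -(setUv (range k1 `|` range k2)) muU ?setICr// muU//.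
rewrite (mu_range k1 s1)// (mu_range k2 s2)// -addrA => /eqP.
rewrite -subr_eq0 addrAC subrr add0r => /eqP m0.
by have : (0 < 1 + mu (~` (range k1 `|` range k2)))%R;
  [rewrite ltr_wpDr | rewrite m0 ltxx].
Qed.

End Amenability.

(** * Homomorphisms at finite distance from a bijection *)

Lemma multiplicativeF {G H : groupType} (rho : {multiplicative G -> H}) :
  {morph rho : g h / (g / h)%g}.
Proof.
by move=> g h; apply: (mulIg (rho h)); rewrite -gmulfM !mulgVK.
Qed.

Section BijectionsNearHomomorphisms.
Local Open Scope group_scope.
Context {G H : groupType} {rho : UMagmaMorphism.type G H} {f : G -> H}.

(** If [rho g = 1] with [g <> 1], the powers of [g] are distinct and
    [f (g ^+ n) / rho (g ^+ n) = f (g ^+ n)], so a finite set would contain infinitely many values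
    of [f]. *)
Lemma torsion_free_injective_near_hom : torsion_free G -> injective f ->
  finite_set (range (fun g => f g / rho g)) -> injective rho.
Proof.
move=> G_tf f_inj frho; apply: gmulf_inj => g rhog; apply: contrapT => g1.
have gX_inj : injective (fun n => g ^+ n).
  suff gX m n : (m < n)%N -> g ^+ m <> g ^+ n.
    by move=> m n gmn; case: (ltngtP m n) => // /gX[].
  move=> mn gmn; apply: g1; apply: (G_tf g (n - m)%N).
    by rewrite subn_gt0.
  by rewrite (expgnFr g (ltnW mn)) gmn mulgV.
have : finite_set ((fun n => f (g ^+ n)) @^-1` range (fun g => f g / rho g)).
  by apply: finite_preimage frho => m n _ _ /f_inj/gX_inj.
rewrite (_ : _ @^-1` _ = [set: nat]); first exact: infinite_nat.
apply/seteqP; split => // n _; exists (g ^+ n) => //.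
by rewrite gmulfXn rhog expg1n divg1.
Qed.

(* If [t] is not in the image of [rho], the maps [g |-> f^-1 (rho g)] and
   [g |-> f^-1 (t * rho g)] are piecewise translations of [G] with finitely
   many pieces and disjoint images. *)
Lemma amenable_surjective_near_hom {R : realType} : amenable R G ->
  injective rho -> bijective f ->
  finite_set (range (fun g => f g / rho g)) ->
  forall t, exists g, rho g = t.
Proof.
move=> G_am rho_inj [f' fK f'K] frho t; apply: contrapT => tP.
pose k s g := f' (s * rho g).
have k_inj s : injective (k s).
  by move=> g h /(can_inj f'K)/mulgI/rho_inj.
have k_fin s : finite_set (range (fun g => k s g / g)).
  (* For [c = f (k s g) / rho (k s g) = s * rho g / rho (k s g)], one has
     [rho (k s g / g) = c^-1 * s]; finitely many [c] and injectivity of [rho] leave finitely many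
     translators. *)
  apply: (@sub_finite_set _ _
    (rho @^-1` [set c^-1 * s | c in range (fun g => f g / rho g)])).
    move=> _ [g _ <-]; exists (f (k s g) / rho (k s g)).
      by exists (k s g).
    by rewrite /k f'K gmulfF invgF invgM mulgA mulgVK.
  by apply: finite_preimage; [move=> ? ? _ _ /rho_inj | exact: finite_image].
apply: (amenable_not_paradoxical (k 1) (k t) G_am) => //.
apply/seteqP; split => // _ [[g _ <-] [h _ /(can_inj f'K)]].
rewrite mul1g => thg; apply: tP; exists (g / h).
by rewrite gmulfF -thg mulgK.
Qed.

End BijectionsNearHomomorphisms.

(** * Locally constant maps into a discrete group *)

Lemma continuous_to_groupP {X : topologicalType} {H : groupType} (u : X -> H) :
  continuous_to_group u <-> forall x, \forall y \near x, u y = u x.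
Proof.
by split => uc x; [have /discrete_cvg := uc x | apply/discrete_cvg; exact: uc].
Qed.

Lemma continuous_to_group_comp {X Y : topologicalType} {H : groupType}
    (u : Y -> H) (f : X -> Y) :
  continuous_to_group u -> continuous f ->
  continuous_to_group (fun x => u (f x)).
Proof.
move=> /continuous_to_groupP uc fc; apply/continuous_to_groupP => x.
exact: (fc x _ (uc (f x))).
Qed.

Section ContinuousToGroup.
Local Open Scope group_scope.
Context {X : topologicalType} {H : groupType}.

Lemma continuous_to_groupM (u v : X -> H) : continuous_to_group u ->
  continuous_to_group v -> continuous_to_group (fun x => u x * v x).
Proof.
move=> /continuous_to_groupP uc /continuous_to_groupP vc.
by apply/continuous_to_groupP => x; near do congr (_ * _);
  [exact: uc | exact: vc].
Unshelve. all: by end_near. Qed.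

Lemma continuous_to_group_finite_range (u : X -> H) : compact [set: X] ->
  continuous_to_group u -> finite_set (range u).
Proof.
move=> /compact_near_coveringP Xc /continuous_to_groupP uc.
have [/(sub_finite_set (@subsetT _ (range u)))//|H_inf] :=
  pselect (finite_set [set: H]).
(* Near each point [u] avoids all but one [h]. Compactness, applied along the cofinite filter,
   yields cofinitely many [h] avoided on all of [X]. *)
pose F : set_system H := @frechet_filter H.
have hP (x : X) : setT x ->
    \forall x' \near x & h \near F, u x' <> h.
  move=> _; exists ([set x' | u x' = u x], ~` [set u x]); last first.
    by move=> [x' h] [/= -> /nesym].
  split; first exact: uc.
  by apply: sub_finite_set (finite_set1 (u x)) => h /contrapT.
have := Xc _ _ _ (frechet_properfilter H_inf) hP.
apply: sub_finite_set => _ [x _ <-] /=.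
by move=> /(_ x I).
Qed.

(** On an open set where [c] and [d] are both constant, [(d x)^-1 * c x] fixes every point;
    topological freeness forces it to be 1. *)
Lemma topologically_free_unique (T : system H X) (c d : X -> H) :
  topologically_free T -> continuous_to_group c -> continuous_to_group d ->
  (forall x, T (c x) x = T (d x) x) -> c =1 d.
Proof.
move=> T_free /continuous_to_groupP cc /continuous_to_groupP dc cdT x.
apply: contrapT => cdx.
have /T_free cd_dense : (d x)^-1 * c x <> 1.
  by move=> /mulg1_eq; rewrite invgK => /esym.
pose P := [set y | c y = c x /\ d y = d x].
have Px : nbhs x P by near=> y; split; near: y; [exact: cc | exact: dc].
have [||y [/interior_subset[cy dy]]] := cd_dense P^°.
- by exists x.
- exact: open_interior.
by apply; rewrite actM -cy cdT dy -actM mulVg act1.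
Unshelve. all: by end_near. Qed.

End ContinuousToGroup.

Section Action.
Local Open Scope group_scope.
Context {G H : groupType} {X Y : topologicalType}.

Lemma system_continuous (T : system H Y) (h : H) : continuous (T h).
Proof. by have [? []] := act_homeo T h. Qed.

Lemma continuous_locally_constant_action (T : system H Y) (u : X -> H)
    (f : X -> Y) :
  continuous_to_group u -> continuous f -> continuous (fun x => T (u x) (f x)).
Proof.
move=> /continuous_to_groupP uc fc x.
have : (fun y => T (u x) (f y)) @ x --> T (u x) (f x).
  by apply: continuous_comp; [exact: fc | exact: system_continuous].
by apply: cvg_trans; apply: near_eq_cvg; near=> y; rewrite (near (uc x) y).
Unshelve. all: by end_near. Qed.

Lemma continuous_from_action_space_slice (a : G * X -> H) (g : G) :
  continuous_from_action_space a -> continuous_to_group (fun x => a (g, x)).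
Proof.
move=> ac; have pc : continuous (fun x : X => (g, x) : discrete_topology G * X).
  by move=> x; apply: (@cvg_pair _ _ _ _ (nbhs (g : discrete_topology G)));
    [exact: cvg_cst | exact: cvg_id].
by move=> x; exact: (@continuous_comp X (discrete_topology G * X)%type
  (discrete_topology H) (pair g) a x (pc x) (ac _)).
Qed.

Lemma continuous_inverse_compact_hausdorff (f : X -> Y) (f' : Y -> X) :
  compact [set: X] -> hausdorff_space Y -> continuous f ->
  cancel f f' -> cancel f' f -> continuous f'.
Proof.
move=> Xc Yh fc fK f'K; apply/continuous_closedP => A Acl.
rewrite (_ : f' @^-1` A = f @` A).
  apply: compact_closed => //; apply: continuous_compact.
    exact: continuous_subspaceT.
  exact: subclosed_compact Acl Xc _.
by apply/seteqP; split => [y Ay|_ [x Ax <-]]; [exists (f' y) | rewrite /= fK].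
Qed.

End Action.

(** * The cocycle of an orbit equivalence *)

Section OrbitEquivalence.
Local Open Scope group_scope.
Context {G H : groupType} {X Y : topologicalType} {S : system G X}
  {T : system H Y} {phi : X -> Y} {psi : Y -> X} {a : G * X -> H}
  {b : H * Y -> G}.
Context (phi_homeo : inverse_homeomorphisms phi psi)
  (a_cont : continuous_from_action_space a)
  (b_cont : continuous_from_action_space b)
  (phiE : forall g x, phi (S g x) = T (a (g, x)) (phi x))
  (psiE : forall h y, psi (T h y) = S (b (h, y)) (psi y)).

Lemma orbit_equivalence_cocycle :
  topologically_free T -> continuous_cocycle S a.
Proof.
move=> T_free; split=> // g1 g2 x.
have [phiK psiK phi_cont psi_cont] := phi_homeo.
have a_psi g (f : Y -> X) : continuous f ->
    continuous_to_group (fun y => a (g, f y)).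
  move=> fc; apply: (continuous_to_group_comp (fun x => a (g, x)) f _ fc).
  exact: continuous_from_action_space_slice.
(* Uniqueness concerns maps on the space acted upon, so both sides are transported to [Y] along
   [psi]. *)
rewrite -[x]phiK; apply: (topologically_free_unique T
  (fun y => a (g1 * g2, psi y))
  (fun y => a (g1, S g2 (psi y)) * a (g2, psi y))).
- exact: T_free.
- exact: a_psi.
- apply: continuous_to_groupM; last exact: a_psi.
  apply: (a_psi g1 (S g2 \o psi)) => y.
  by apply: continuous_comp; [exact: psi_cont | exact: system_continuous].
- by move=> y; rewrite -{2}[y]psiK -phiE !actM phiE phiE psiK.
Qed.

(** Both group elements send [x] to [S g x], so freeness of [S] identifies them. Used in both
    directions, this makes each [a (-, x)] a bijection. *)
Lemma orbit_equivalence_cocycleK : topologically_free S ->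
  forall x g, b (a (g, x), phi x) = g.
Proof.
move=> S_free x g; have [phiK psiK phi_cont psi_cont] := phi_homeo.
apply: (topologically_free_unique S (fun x => b (a (g, x), phi x)) (fun=> g)).
- exact: S_free.
- apply/continuous_to_groupP => {}x.
  have /continuous_to_groupP ac :=
    continuous_from_action_space_slice a g a_cont.
  have /continuous_to_groupP bc :=
    continuous_from_action_space_slice b (a (g, x)) b_cont.
  near=> y; rewrite (near (ac x) y)//; near: y.
  exact: (phi_cont x _ (bc (phi x))).
- by move=> ?; exact: cvg_cst.
- by move=> {}x; rewrite -{3}[x]phiK -psiE -phiE phiK.
Unshelve. all: by end_near. Qed.

End OrbitEquivalence.

Theorem theorem1p6 (R : realType) (G H : groupType) (X Y : topologicalType)
    (S : system G X) (T : system H Y)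
    (G_countable : countable [set: G]) (H_countable : countable [set: H])
    (X_nonempty : [set: X] !=set0)
    (X_hausdorff : hausdorff_space X) (Y_hausdorff : hausdorff_space Y)
    (X_compact : compact [set: X]) (Y_compact : compact [set: Y])
    (G_torsion_free : torsion_free G) (G_amenable : amenable R G)
    (S_free : topologically_free S) (T_free : topologically_free T)
    (ST_coe : continuously_orbit_equivalent S T)
    (S_rigid : continuous_cocycle_rigid H S) :
  conjugate S T.
Proof.
have [phi [psi [a [b [phi_homeo a_cont b_cont phiE psiE]]]]] := ST_coe.
have [phiK psiK phi_cont psi_cont] := phi_homeo.
have psi_homeo : inverse_homeomorphisms psi phi by [].
have baK := orbit_equivalence_cocycleK phi_homeo a_cont b_cont phiE psiE S_free.
have abK := orbit_equivalence_cocycleK psi_homeo b_cont a_cont psiE phiE T_free.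
have [rho [u u_cont aE]] :=
  S_rigid a (orbit_equivalence_cocycle phi_homeo a_cont phiE T_free).
have [x0 _] := X_nonempty.
(* This is the bijection [a (-, x0)] followed by right multiplication by [u x0], while [f g / rho g]
   lies in the finite range of [u]. *)
pose f g := (u (S g x0) * rho g)%g.
have fE g : (f g = a (g, x0) * u x0)%g by rewrite aE mulgVK.
have f_bij : bijective f.
  exists (fun h => b (h * (u x0)^-1, phi x0)%g) => [g|h].
    by rewrite fE mulgK baK.
  by have := abK (phi x0) (h * (u x0)^-1)%g; rewrite fE phiK => ->;
    rewrite mulgVK.
pose rhoM := HB.pack_for (UMagmaMorphism.type G H) (rho : G -> H)
  (isGroupMorphism.Build G H rho (multiplicativeF rho)).
have f_near : finite_set (range (fun g => f g / rho g)%g).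
  apply: sub_finite_set (continuous_to_group_finite_range u X_compact u_cont).
  by move=> _ [g _ <-]; exists (S g x0); rewrite // mulgK.
have rho_inj : injective rho.
  exact: (@torsion_free_injective_near_hom G H rhoM f G_torsion_free
    (bij_inj f_bij) f_near).
have rho_surj : forall h, exists g, rho g = h.
  exact: (@amenable_surjective_near_hom G H rhoM f R G_amenable rho_inj
    f_bij f_near).
pose phi' x := T (u x)^-1%g (phi x).
have phi'E g x : phi' (S g x) = T (rho g) (phi' x).
  by rewrite /phi' phiE aE -!actM !mulgA mulVg mul1g.
have phi'_cont : continuous phi'.
  apply: continuous_locally_constant_action phi_cont.
  by apply/continuous_to_groupP => x; near do congr (_^-1)%g;
    move/continuous_to_groupP: u_cont; apply.
have phi'_inj : injective phi'.
  move=> x y xy.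
  (* Equality of [phi' x] and [phi' y] says that [u y * (u x)^-1] carries [phi x] to [phi y]; [b]
     turns this into an element of [G] carrying [x] to [y]. *)
  have yE : y = S (b (u y * (u x)^-1, phi x)%g) x.
    by rewrite -{3}[x]phiK -psiE actM -/(phi' x) xy /phi' -actM mulgV act1 phiK.
  set g := b _ in yE.
  (* Here [a (g, x)] equals both [u y * (u x)^-1] and [u y * rho g * (u x)^-1], whence
     [rho g = 1]. *)
  have := abK (phi x) (u y * (u x)^-1)%g.
  rewrite phiK -/g aE -yE => /mulIg; rewrite -[RHS]mulg1 => /mulgI rhog.
  have g1 : g = 1%g.
    by apply: rho_inj; rewrite rhog; exact/esym/(@gmulf1 _ _ rhoM).
  by rewrite yE g1 act1.
have phi'_surj y : exists x, phi' x = y.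
  (* Acting by [rho g = u (psi y)] cancels the twist [(u (psi y))^-1] in [phi' (psi y)]. *)
  have [g gE] := rho_surj (u (psi y)).
  by exists (S g (psi y)); rewrite phi'E gE /phi' -actM mulgV act1 psiK.
have [phi'V phi'VK] := choice phi'_surj.
exists phi', rho; split => //.
- have phi'K : cancel phi' phi'V by move=> x; apply: phi'_inj.
  exists phi'V; split => //.
  exact: continuous_inverse_compact_hausdorff phi'_cont phi'K phi'VK.
- have [rhoV rhoVK] := choice rho_surj.
  by exists rhoV => // g; apply: rho_inj.
Unshelve. all: by end_near. Qed.
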